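(* Fix $\delta\in(0,1)$. Suppose $\lambda_{\min}(\Psi^\top D\Psi)\ge\sigma$ for some $\sigma>0$, where $D=\mathrm{diag}(\mu_e\otimes u)$. Let $\widehat w\in\arg\min_w\sum_{j=1}^m\left(Q_\pi^*(x_j,a_j)-w^\top\psi(x_j,a_j)\right)^2$ be the least-squares Monte-Carlo estimate computed from $m$ samples, and let $\widetilde w=\arg\min_w\|Q_\pi-\Psi w\|_{\mu_e\otimes u}$ be the best linear approximation. Then, with probability at least $1-\delta$, $$\|\Psi(\widehat w-\widetilde w)\|_{\mu_e\otimes u}=O\left(\sigma^{-1/2}\sqrt{\log(1/\delta)/m}\right),$$ where the constant hidden in $O(\cdot)$ does not depend on $m$, $\delta$ or $\sigma$.
   Context: Finite Markov decision process with states $[S]$, actions $[A]$, and cost function $c$ with $\|c\|_\infty\le 1$. Under every policy the states form a single recurrent class, and policies mix uniformly fast: there is $\kappa>0$ such that for every policy $\pi$ with state transition matrix $P_\pi$ and stationary state distribution $\mu_\pi$, and every distribution $\mu'$, $\|(\mu_\pi-\mu')^\top P_\pi\|_1\le e^{-1/\kappa}\|\mu_\pi-\mu'\|_1$. $\pi$ is a target policy with average cost $\lambda_\pi$, and $Q_\pi(x,a)$ is its action-value: the expected total of (cost minus $\lambda_\pi$) when starting in state $x$, taking action $a$ first, and following $\pi$ afterwards. $\pi_e$ is an exploration policy with stationary state distribution $\mu_e$; $u$ is the uniform distribution on $[A]$; $(\mu_e\otimes u)(x,a)=\mu_e(x)u(a)$. $\Psi\in\mathbb{R}^{SA\times d}$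 is a feature matrix with rows $\psi(x,a)^\top$. $\|f\|_\nu=(\sum_{x,a}\nu(x,a)f(x,a)^2)^{1/2}$. It is assumed that $\|\widetilde w\|\le W_{\max}$ for a constant $W_{\max}$, uniformly over policies. Data: for $j=1,\dots,m$, independently, $(x_j,a_j)\sim\mu_e\otimes u$; $x'_j$ is the next state observed after taking action $a_j$ in state $x_j$; then $\pi$ is run from $x'_j$ for $s$ steps ($s$ sufficiently large compared with the mixing time), and $c^{(j)}_1,\dots,c^{(j)}_s$ denote the successive costs along this rollout. The regression target is $Q_\pi^*(x_j,a_j)=c(x_j,a_j)-\lambda^*_\pi+V^*_\pi(x'_j)$, with $V^*_\pi(x'_j)=\sum_{k=1}^s(c^{(j)}_k-\lambda^*_\pi)$ and $\lambda^*_\pi=c^{(j)}_s$. Convention: the bias of the targets due to the finite rollout length, which is exponentially small in $s$, is ignored, i.e. $\mathbf{E}[Q_\pi^*(x_j,a_j)\mid x_j,a_j]=Q_\pi(x_j,a_j)$.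
   Formalization: The bound is proved for δ up to an arbitrary fixed cap below 1 on which the constant may depend (log(1/δ) vanishes at δ=1, where a uniform constant fails), and for m at least a threshold depending on δ and σ (for small m the least-squares minimizer is not unique and is unbounded). *)

(* Defs.v *)
(* MathComp / MathComp-Analysis; the reals are an arbitrary [R : realType]. *)
From HB Require Import structures.
From mathcomp Require Import all_boot all_order all_algebra.
From mathcomp Require Import all_classical all_reals all_analysis.

Set Implicit Arguments.
Unset Strict Implicit.
Unset Printing Implicit Defensive.

Import Order.TTheory GRing.Theory Num.Theory.
Import numFieldNormedType.Exports.

Local Open Scope classical_set_scope.
Local Open Scope ring_scope.

Section Vectors.
Context {R : realType}.

Definition l1norm n (v : 'rV[R]_n) : R := \sum_i `|v 0 i|.

(* The canonical norm on matrices is the sup norm, hence this definition. *)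
Definition l2norm n (v : 'cV[R]_n) : R := Num.sqrt (\sum_i v i 0 ^+ 2).

Definition is_dist (T : finType) (p : T -> R) : Prop :=
  (forall t, 0 <= p t) /\ \sum_t p t = 1.

Definition is_argmin (T : Type) (f : T -> R) (x : T) : Prop :=
  forall y, f x <= f y.

(* [lambda_min M >= l], for a symmetric [M] (all its eigenvalues are real). *)
Definition lambda_min_ge n (M : 'M[R]_n) (l : R) : Prop :=
  forall a, eigenvalue M a -> l <= a.

End Vectors.

Section MDP.
Context {R : realType} {S A : nat}.

(* [P x a y] is the probability of moving to [y] when [a] is taken in [x]. *)
Implicit Types (P : 'I_S -> 'I_A -> 'I_S -> R) (c Q f nu : 'I_S -> 'I_A -> R).
Implicit Types (pi : 'I_S -> 'I_A -> R) (mu : 'rV[R]_S).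

Definition is_mdp P c : Prop :=
  (forall x a, is_dist (P x a)) /\ (forall x a, `|c x a| <= 1).

Definition is_policy pi : Prop := forall x, is_dist (pi x).

Definition trans P pi : 'M[R]_S := \matrix_(x, y) \sum_a pi x a * P x a y.

Definition stationary P pi mu : Prop :=
  is_dist (mu 0) /\ mu *m trans P pi = mu.

(* All states communicate; in a finite chain the single closed class formed by
   all the states is then recurrent. *)
Definition single_recurrent_class P pi : Prop :=
  forall x y, exists n : nat, 0 < (trans P pi ^+ n) x y.

Definition recurrent_mdp P : Prop :=
  forall pi, is_policy pi -> single_recurrent_class P pi.

Definition uniformly_mixing P (kappa : R) : Prop :=
  forall pi mu (mu' : 'rV[R]_S), is_policy pi -> stationary P pi mu ->
    is_dist (mu' 0) ->
    l1norm ((mu - mu') *m trans P pi)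
      <= expR (- kappa^-1) * l1norm (mu - mu').

(* Expected cost incurred at time [t] under [pi], started in state [x]. *)
Definition exp_cost P c pi (t : nat) (x : 'I_S) : R :=
  (trans P pi ^+ t *m (\col_y \sum_a pi y a * c y a)) x 0.

Definition average_cost P c pi (lam : R) : Prop :=
  forall x, (fun n : nat => n%:R^-1 * \sum_(t < n) exp_cost P c pi t x)
              @ \oo --> lam.

Definition action_value P c pi (lam : R) Q : Prop :=
  forall x a,
    (fun n : nat => c x a - lam +
       \sum_(t < n) (\sum_y P x a y * exp_cost P c pi t y - lam))
      @ \oo --> Q x a.

(* The distribution [mu (x) u], with [u] uniform on the actions. *)
Definition prod_unif mu : 'I_S -> 'I_A -> R := fun x _ => mu 0 x * A%:R^-1.

Definition wnorm nu f : R := Num.sqrt (\sum_x \sum_a nu x a * f x a ^+ 2).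

Section Features.
Context {d : nat}.

(* State-action pairs index the rows of [Psi] through [mxvec_index]. *)
Implicit Types (Psi : 'M[R]_(S * A, d)) (w : 'cV[R]_d).

Definition feature Psi (x : 'I_S) (a : 'I_A) : 'cV[R]_d :=
  (row (mxvec_index x a) Psi)^T.

Definition lin_fun Psi w : 'I_S -> 'I_A -> R :=
  fun x a => (Psi *m w) (mxvec_index x a) 0.

Definition cov_matrix nu Psi : 'M[R]_d :=
  Psi^T *m diag_mx (mxvec (\matrix_(x, a) nu x a)) *m Psi.

Definition best_approx nu Psi Q w : Prop :=
  is_argmin (fun w' => wnorm nu (fun x a => Q x a - lin_fun Psi w' x a)) w.

End Features.

End MDP.

Section Data.
Context {R : realType} {S A : nat}.
Implicit Types (P : 'I_S -> 'I_A -> 'I_S -> R) (c nu pi : 'I_S -> 'I_A -> R).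

(* One data point: index 0 carries the sampled pair [(x_j, a_j)], and index
   [k >= 1] the state-action pair at step [k] of the rollout; in particular the
   state at index 1 is [x'_j]. *)
Definition traj (s : nat) : finType := {ffun 'I_s.+1 -> 'I_S * 'I_A}.

Definition traj_pmf P pi nu s (tau : traj s) : R :=
  nu (tau ord0).1 (tau ord0).2 *
  \prod_(k < s)
    (let z := tau (widen_ord (leqnSn s) k) in
     let z' := tau (lift ord0 k) in
     P z.1 z.2 z'.1 * pi z'.1 z'.2).

(* [Q* (x_j, a_j) = c (x_j, a_j) - lam* + \sum_(1 <= k <= s) (c_k - lam* )],
   where [lam* = c_s]. *)
Definition target c s (tau : traj s) : R :=
  let cost k := c (tau k).1 (tau k).2 in
  let lam_star := cost ord_max in
  let V_star := \sum_(k < s) (cost (lift ord0 k) - lam_star) in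
  cost ord0 - lam_star + V_star.

Definition cond_exp_start s (p f : traj s -> R) (x : 'I_S) (a : 'I_A) : R :=
  (\sum_(tau : traj s | tau ord0 == (x, a)) p tau * f tau) /
  (\sum_(tau : traj s | tau ord0 == (x, a)) p tau).

Definition dataset (s m : nat) : finType := {ffun 'I_m -> traj s}.

(* Probability of the event [E] for [m] independent draws from [p]. *)
Definition data_prob s m (p : traj s -> R) (E : pred (dataset s m)) : R :=
  \sum_(D : dataset s m | E D) \prod_(j < m) p (D j).

Definition sq_loss c d (Psi : 'M[R]_(S * A, d)) s m (D : dataset s m)
    (w : 'cV[R]_d) : R :=
  \sum_(j < m)
    (target c (D j) -
     (w^T *m feature Psi (D j ord0).1 (D j ord0).2) 0 0) ^+ 2.

End Data.

Arguments traj : clear implicits.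
Arguments dataset : clear implicits.

(* Main.v *)
(* Write [v = what - wt] and [N] for the norm of [Psi v] in [L^2(nu)]: [N^2]
   is a quadratic form in [v] whose matrix is the covariance of the features,
   hence [N^2 >= sigma |v|^2]. A Chernoff bound applied to the entries of the
   empirical covariance and to the coordinates of the empirical mean [g] of
   [(target - wt . psi) psi], which is centered by unbiasedness and optimality
   of [wt], bounds all deviations by [t ~ sqrt (ln (1 / delta) / m)] with
   probability [1 - delta]. For [m] large, [t] is small against [sigma], so
   the empirical form dominates [N^2 / 2]; it equals [v . g] by the normal
   equations of [what]. Thus [N^2 <= 2 t sqrt d |v| <= 2 t sqrt d N / sqrt
   sigma]. *)
Require Import Defs.
From mathcomp Require Import all_boot all_order all_algebra.
From mathcomp Require Import all_classical all_reals all_analysis.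
From mathcomp Require Import ring lra.

Import Order.TTheory GRing.Theory Num.Theory.
Import numFieldNormedType.Exports.
Local Open Scope ring_scope.

Set Implicit Arguments.
Unset Strict Implicit.
Unset Printing Implicit Defensive.

(** * First-order optimality and symmetric quadratic forms *)

(** The test point [- b / k] with [k > c] gives the value [(b / k) ^+ 2 * (c - k)], negative unless
    [b = 0]. This replaces a vanishing derivative wherever minimality along a line is used. *)
Lemma linear_coef_eq0 (R : realFieldType) (b c : R) :
  (forall t, 0 <= b * t + c * t ^+ 2) -> b = 0.
Proof.
move=> h; apply/eqP; apply/negP => /negP b0.
set k := `|c| + 1.
have k0 : 0 < k by rewrite ltr_pwDr.
have ck : c < k by rewrite (le_lt_trans (ler_norm c)) // ltrDl.
have := h (- b / k).
have -> : b * (- b / k) + c * (- b / k) ^+ 2 = (b / k) ^+ 2 * (c - k).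
  by field; rewrite gt_eqF.
rewrite leNgt pmulr_rlt0 ?subr_lt0 ?ck //.
by rewrite exprn_even_gt0 //= mulf_neq0 // invr_neq0 // gt_eqF.
Qed.

(** Cauchy-Schwarz against the all-ones vector, by the inequality of arithmetic and geometric means
    on each product [|v i| * |v j|]. *)
Lemma sqr_sum_norm_le (R : realFieldType) d (v : 'I_d -> R) :
  (\sum_i `|v i|) ^+ 2 <= d%:R * \sum_i v i ^+ 2.
Proof.
have -> : d%:R * \sum_i v i ^+ 2
    = \sum_(i < d) \sum_(j < d) (v i ^+ 2 / 2 + v j ^+ 2 / 2).
  under [RHS]eq_bigr => i _ do rewrite big_split /= sumr_const card_ord.
  rewrite big_split /= sumr_const card_ord sumrMnl -mulr_suml -mulr_natl.
  lra.
rewrite expr2 big_distrlr; apply: ler_sum => i _; apply: ler_sum => j _ /=.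
have := sqr_ge0 (`|v i| - `|v j|).
rewrite -(real_normK (num_real (v i))) -(real_normK (num_real (v j))).
by nra.
Qed.

Lemma continuous_sum (R : realType) (T : topologicalType) (I : Type)
    (r : seq I) (F : I -> T -> R) :
  (forall i, continuous (F i)) -> continuous (fun x => \sum_(i <- r) F i x).
Proof.
move=> cF; elim: r => [|i r IH] x.
  by under eq_fun do rewrite big_nil; apply: cvg_cst.
by under eq_fun do rewrite big_cons; apply: cvgD; [exact: cF|exact: IH].
Qed.

(* The minimum of the Rayleigh quotient is attained on the compact unit sphere,
   and by first-order optimality it is an eigenvalue. *)
Lemma symmetric_form_ge (R : realType) n (M : 'M[R]_n) (l : R) (u : 'rV[R]_n) :
  M^T = M -> lambda_min_ge M l -> l * \sum_i u 0 i ^+ 2 <= (u *m M *m u^T) 0 0.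
Proof.
case: n => [|n] in M u *.
  by move=> _ _; rewrite mxE !big_ord0 mulr0.
move=> symM minM.
pose q (N : 'M[R]_n.+1) (v : 'rV[R]_n.+1) : R := (v *m N *m v^T) 0 0.
have q1E v : q 1%:M v = \sum_i v 0 i ^+ 2.
  by rewrite /q mulmx1 mxE; apply: eq_bigr => i _; rewrite mxE expr2.
have qE N v : q N v = \sum_i (\sum_j v 0 j * N j i) * v 0 i.
  by rewrite /q mxE; apply: eq_bigr => i _; rewrite !mxE.
have qZ N t v : q N (t *: v) = t ^+ 2 * q N v.
  by rewrite /q linearZ /= -!scalemxAl -scalemxAr !mxE; ring.
have cq N : continuous (q N).
  have -> : q N = fun v => \sum_i (\sum_j v 0 j * N j i) * v 0 i.
    by apply/funext => v; rewrite qE.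
  have c0 j : continuous (fun v : 'rV[R]_n.+1 => v 0 j).
    exact: coord_continuous.
  have cM (f g : 'rV[R]_n.+1 -> R) : continuous f -> continuous g ->
      continuous (fun v => f v * g v).
    by move=> cf cg y; apply: (@cvgM _ _ (nbhs y)); [exact: cf|exact: cg].
  have cC (a : R) : continuous (fun _ : 'rV[R]_n.+1 => a).
    exact: cst_continuous.
  apply: (@continuous_sum _ _ _ _
    (fun i (v : 'rV[R]_n.+1) => (\sum_j v 0 j * N j i) * v 0 i)) => i.
  apply: (cM (fun v => \sum_j v 0 j * N j i) (fun v => v 0 i)) => //.
  apply: (@continuous_sum _ _ _ _
    (fun j (v : 'rV[R]_n.+1) => v 0 j * N j i)) => j.
  exact: (cM (fun v => v 0 j) (fun=> N j i)).
pose A : set 'rV[R]_n.+1 := (q 1%:M @^-1` [set 1])%classic.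
have clA : closed A.
  apply: preimage_closed; last exact: closed_eq.
  by move=> x _; exact: cq.
have bA : bounded_set A.
  exists 1; split; first exact: num_real.
  move=> x x1 v; rewrite /A /= q1E => v1; apply: le_trans (ltW x1).
  rewrite [leLHS]/Num.norm /= mx_normrE.
  apply/bigmax_leP; split => // -[i j] _ /=.
  rewrite (ord1 i) -(@ler_pXn2r _ 2) ?nnegrE // expr1n real_normK ?num_real //.
  rewrite -v1 (bigD1 j) //= lerDl; apply: sumr_ge0 => k _; exact: sqr_ge0.
have nA : (A !=set0)%classic.
  exists (delta_mx 0 0); rewrite /A /= q1E (bigD1 0) //= mxE eqxx expr1n.
  by rewrite big1 ?addr0 // => i i0; rewrite mxE (negbTE i0) expr0n.
have cA := bounded_closed_compact bA clA.
have [|u0 u0A u0min] := compact_EVT_min nA cA (f := q M).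
  by apply: continuous_subspaceT; exact: cq.
have u01 : q 1%:M u0 = 1 by move: u0A; rewrite inE.
set a := q M u0 in u0min.
(* Homogeneity carries the minimum from the unit sphere to every vector. *)
have amin v : a * q 1%:M v <= q M v.
  have [v0|v0] := eqVneq (q 1%:M v) 0.
    suff -> : v = 0 by rewrite /q !mul0mx !mxE mulr0.
    apply/rowP => i; rewrite mxE; apply/eqP; rewrite -sqrf_eq0.
    move: v0; rewrite q1E => /eqP.
    rewrite psumr_eq0 => [|j _]; last exact: sqr_ge0.
    by move=> /allP/(_ i); rewrite mem_index_enum => /(_ isT).
  have v0' : 0 < q 1%:M v.
    by rewrite lt_neqAle eq_sym v0 q1E sumr_ge0 // => i _; exact: sqr_ge0.
  set r := Num.sqrt (q 1%:M v).
  have r2 : r ^+ 2 = q 1%:M v by rewrite sqr_sqrtr // ltW.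
  have r0 : r != 0 by rewrite -sqrf_eq0 r2.
  have : a <= q M (r^-1 *: v).
    by apply: u0min; rewrite inE /A /= qZ exprVn r2 mulVf.
  by rewrite qZ exprVn r2 ler_pdivlMl // mulrC.
(* The form of [N] is nonnegative and vanishes at [u0]. Along [u0 + t *: g] with [g = u0 *m N] its
   linear coefficient is [2 |g|^2], which must therefore be zero. *)
have [N NE] : exists N, N = M - a%:M by exists (M - a%:M).
have qN v : q N v = q M v - a * q 1%:M v.
  by rewrite /q NE mulmxBr mulmxBl -[a%:M]scalemx1 -scalemxAr -scalemxAl !mxE.
have symN : N^T = N by rewrite NE linearB /= tr_scalar_mx symM.
have qND (v : 'rV[R]_n.+1) t : q N (u0 + t *: v)
    = q N u0 + 2 * (u0 *m N *m v^T) 0 0 * t + q N v * t ^+ 2.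
  have sw : (v *m N *m u0^T) 0 0 = (u0 *m N *m v^T) 0 0.
    have <- : (u0 *m N *m v^T)^T = v *m N *m u0^T.
      by rewrite !trmx_mul trmxK symN mulmxA.
    by rewrite mxE.
  have -> : q N (u0 + t *: v) = ((u0 + t *: v) *m N *m (u0^T + t *: v^T)) 0 0.
    by congr (fun_of_matrix (_ *m _) _ _); apply/matrixP => i j; rewrite !mxE.
  rewrite /q !mulmxDl !mulmxDr -!scalemxAl -!scalemxAr.
  have mD (X Y : 'M[R]_1) : (X + Y) 0 0 = X 0 0 + Y 0 0 by rewrite mxE.
  have mZ (X : 'M[R]_1) : (t *: X) 0 0 = t * X 0 0 by rewrite mxE.
  by rewrite !(mD, mZ) sw; ring.
have eig : u0 *m N = 0.
  pose g := u0 *m N.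
  have : 2 * (g *m g^T) 0 0 = 0.
    apply: (@linear_coef_eq0 _ _ (q N g)) => t.
    have := amin (u0 + t *: g); rewrite -subr_ge0 -qN qND qN u01 mulr1 subrr.
    by rewrite add0r.
  move=> /eqP; rewrite mulf_eq0 pnatr_eq0 /= => /eqP.
  have -> : (g *m g^T) 0 0 = \sum_i g 0 i ^+ 2.
    by rewrite mxE; apply: eq_bigr => i _; rewrite [g^T _ _]mxE expr2.
  move=> /eqP; rewrite psumr_eq0 => [/allP g0|j _]; last exact: sqr_ge0.
  apply/rowP => i; rewrite [RHS]mxE; apply/eqP; rewrite -sqrf_eq0.
  by have := g0 i; rewrite mem_index_enum => /(_ isT).
have la : l <= a.
  apply: minM; apply/eigenvalueP; exists u0.
    by move/eqP: eig; rewrite NE mulmxBr subr_eq0 mul_mx_scalar => /eqP.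
  apply/eqP => u00; move: u01; rewrite u00 /q !mul0mx mxE => /eqP.
  by rewrite eq_sym oner_eq0.
rewrite -q1E; apply: le_trans (amin u); apply: ler_wpM2r => //.
by rewrite q1E sumr_ge0 // => i _; exact: sqr_ge0.
Qed.

(** * Chernoff bounds for independent draws from a finite distribution *)

(** From [1 - x <= expR (- x)], and [(1 - x) (1 + x + 2 x^2) = 1 + x^2 (1 - 2 x) >= 1]. *)
Lemma expR_le_quadratic (R : realType) (x : R) :
  x <= 2^-1 -> expR x <= 1 + x + 2 * x ^+ 2.
Proof.
move=> x2.
have h := expR_ge1Dx (- x).
have x1 : 0 < 1 - x by lra.
have : expR x <= (1 - x)^-1.
  by rewrite -[expR x]invrK -expRN lef_pV2 ?posrE ?expR_gt0.
move=> /le_trans; apply.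
rewrite -[leLHS]mul1r ler_pdivrMr //.
have := sqr_ge0 x; nra.
Qed.

(** Convertible to [data_prob] when [T] is a type of trajectories; the bounds below do not look
    inside a draw. *)
Definition iid_prob (R : realType) (T : finType) (p : T -> R) m
    (E : pred {ffun 'I_m -> T}) : R :=
  \sum_(D : {ffun 'I_m -> T} | E D) \prod_(j < m) p (D j).

Section Concentration.
Variables (R : realType) (T : finType) (p : T -> R).
Hypothesis p_dist : is_dist p.

Let p_ge0 t : 0 <= p t. Proof. by case: p_dist. Qed.
Let p_sum1 : \sum_t p t = 1. Proof. by case: p_dist. Qed.

Lemma iid_pmf_ge0 m (D : {ffun 'I_m -> T}) : 0 <= \prod_(j < m) p (D j).
Proof. by apply: prodr_ge0. Qed.

Lemma iid_pmf_sum1 m : \sum_(D : {ffun 'I_m -> T}) \prod_(j < m) p (D j) = 1.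
Proof.
by rewrite -(bigA_distr_bigA (fun (j : 'I_m) t => p t)) big1.
Qed.

Lemma iid_probC m (E : pred {ffun 'I_m -> T}) :
  iid_prob p E = 1 - iid_prob p (fun D => ~~ E D).
Proof. by rewrite -(iid_pmf_sum1 m) (bigID E) /= addrK. Qed.

Lemma iid_prob_mono m (E F : pred {ffun 'I_m -> T}) :
  (forall D, E D -> F D) -> iid_prob p E <= iid_prob p F.
Proof.
move=> EF; rewrite /iid_prob [leRHS](bigID E) /=.
rewrite [X in _ <= X + _](eq_bigl E) => [|D]; last first.
  by case ED: (E D); rewrite ?andbT ?andbF ?EF.
by rewrite lerDl; apply: sumr_ge0 => D _; exact: iid_pmf_ge0.
Qed.

Lemma iid_prob_exists_le m (I : finType) (E : I -> pred {ffun 'I_m -> T}) :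
  iid_prob p (fun D => [exists i, E i D]) <= \sum_i iid_prob p (E i).
Proof.
rewrite /iid_prob.
under [leRHS]eq_bigr => i _ do rewrite big_mkcond /=.
rewrite exchange_big /= big_mkcond /=; apply: ler_sum => D _.
case: ifP => [/existsP [i Ei]|_]; last first.
  by apply: sumr_ge0 => i _; case: ifP => // _; exact: iid_pmf_ge0.
rewrite (bigD1 i) //= Ei lerDl; apply: sumr_ge0 => k _.
by case: ifP => // _; exact: iid_pmf_ge0.
Qed.

Lemma chernoff_upper m (f : T -> R) (K t : R) :
  0 < K -> 0 <= t -> t <= 2 * K ->
  (forall x, `|f x| <= K) -> \sum_x p x * f x = 0 ->
  iid_prob p (fun D : {ffun 'I_m -> T} => m%:R * t < \sum_j f (D j))
    <= expR (- (m%:R * t ^+ 2 / (8 * K ^+ 2))).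
Proof.
move=> K0 t0 tK fK f0.
(* This [th] minimises the exponent [2 th^2 K^2 - th t], with value [- t^2 / (8 K^2)]. The bound
   [t <= 2 * K] gives [th * f x <= 1 / 2], the range of the quadratic bound on [expR]. *)
pose th := t / (4 * K ^+ 2).
have th0 : 0 <= th by rewrite divr_ge0 // mulr_ge0 // sqr_ge0.
have mgf : \sum_x p x * expR (th * f x) <= expR (2 * th ^+ 2 * K ^+ 2).
  apply: (@le_trans _ _ (\sum_x p x * (1 + th * f x + 2 * th ^+ 2 * K ^+ 2))).
    apply: ler_sum => x _; apply: ler_wpM2l => //.
    have thK : th * K <= 2^-1.
      rewrite /th mulrAC ler_pdivrMr ?mulr_gt0 ?exprn_gt0 //; nra.
    apply: le_trans (@expR_le_quadratic _ _ _) _.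
      apply: le_trans thK; apply: ler_wpM2l => //.
      exact: le_trans (ler_norm _) (fK x).
    rewrite lerD2l exprMn mulrA; apply: ler_wpM2l.
      by rewrite mulr_ge0 // sqr_ge0.
    rewrite -(real_normK (num_real (f x))).
    by apply: lerXn2r; rewrite ?nnegrE // ltW.
  rewrite (eq_bigr
    (fun x => p x * (1 + 2 * th ^+ 2 * K ^+ 2) + th * (p x * f x)));
    last by move=> x _; ring.
  rewrite big_split /= -mulr_sumr f0 mulr0 addr0 -mulr_suml p_sum1 mul1r.
  exact: expR_ge1Dx.
(* Exponential Markov inequality; by independence the sum over samples then factors into [m] equal
   moment generating functions. *)
apply: (@le_trans _ _ (\sum_(D : {ffun 'I_m -> T})
   expR (- (th * (m%:R * t))) * \prod_(j < m) (p (D j) * expR (th * f (D j))))).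
  rewrite /iid_prob big_mkcond /=; apply: ler_sum => D _.
  rewrite big_split /= -expR_sum mulrCA -expRD -mulr_sumr.
  case: ifP => [hD|_].
    rewrite -[leLHS]mulr1; apply: ler_wpM2l; first exact: iid_pmf_ge0.
    by rewrite -[leLHS]expR0 ler_expR addrC -mulrBr mulr_ge0 // subr_ge0 ltW.
  by rewrite mulr_ge0 ?iid_pmf_ge0 ?expR_ge0.
rewrite -mulr_sumr.
rewrite -(bigA_distr_bigA (fun (j : 'I_m) x => p x * expR (th * f x))).
rewrite big_const_ord iter_mulr_1.
apply: (@le_trans _ _
  (expR (- (th * (m%:R * t))) * expR (2 * th ^+ 2 * K ^+ 2) ^+ m)).
  apply: ler_wpM2l; first exact: expR_ge0.
  apply: lerXn2r; rewrite ?nnegrE ?expR_ge0 //.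
  by apply: sumr_ge0 => x _; rewrite mulr_ge0 ?expR_ge0.
rewrite -expRM_natl -expRD ler_expR le_eqVlt; apply/orP; left; apply/eqP.
by rewrite /th; field; rewrite gt_eqF.
Qed.

Lemma chernoff_abs m (f : T -> R) (K t : R) :
  0 < K -> 0 <= t -> t <= 2 * K ->
  (forall x, `|f x| <= K) -> \sum_x p x * f x = 0 ->
  iid_prob p (fun D : {ffun 'I_m -> T} => m%:R * t < `|\sum_j f (D j)|)
    <= 2 * expR (- (m%:R * t ^+ 2 / (8 * K ^+ 2))).
Proof.
move=> K0 t0 tK fK f0.
pose E (b : bool) (D : {ffun 'I_m -> T}) :=
  m%:R * t < \sum_j (if b then f (D j) else - f (D j)).
apply: (@le_trans _ _ (iid_prob p (fun D => [exists b, E b D]))).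
  apply: iid_prob_mono => D; rewrite lter_normr => /orP[hD|hD]; apply/existsP.
    by exists true.
  by exists false; rewrite /E sumrN.
apply: (le_trans (iid_prob_exists_le E)).
rewrite big_bool /= mulr_natl mulr2n; apply: lerD.
  exact: (@chernoff_upper m f).
apply: (@chernoff_upper m (fun x => - f x)) => //.
  by move=> x; rewrite normrN.
by under eq_bigr do rewrite mulrN; rewrite sumrN f0 oppr0.
Qed.

Lemma uniform_deviation m (I : finType) (f : I -> T -> R) (K t : R) :
  0 < K -> 0 <= t -> t <= 2 * K ->
  (forall i x, `|f i x| <= K) -> (forall i, \sum_x p x * f i x = 0) ->
  1 - #|I|%:R * (2 * expR (- (m%:R * t ^+ 2 / (8 * K ^+ 2)))) <=
  iid_prob p (fun D : {ffun 'I_m -> T} =>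
                [forall i, `|\sum_j f i (D j)| <= m%:R * t]).
Proof.
move=> K0 t0 tK fK f0; rewrite iid_probC lerD2l lerN2.
under eq_fun => D do rewrite negb_forall.
apply: (le_trans (iid_prob_exists_le _)).
have -> x : #|I|%:R * x = \sum_(i : I) x :> R by rewrite sumr_const mulr_natl.
apply: ler_sum => i _.
under eq_fun => D do rewrite -ltNge.
exact: chernoff_abs.
Qed.

End Concentration.

(** * Deterministic least-squares error *)

(** The sum is the linear coefficient in [t] of the squared loss, up to the factor [- 2]. It serves
    both the population loss, with weights [nu], and the empirical loss, with weights 1. *)
Lemma weighted_normal_equation (R : realFieldType) (I : finType)
    (p r g : I -> R) :
  (forall t, \sum_i p i * r i ^+ 2 <= \sum_i p i * (r i - t * g i) ^+ 2) ->
  \sum_i p i * (r i * g i) = 0.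
Proof.
move=> h; suff : - 2 * \sum_i p i * (r i * g i) = 0 by lra.
apply: (@linear_coef_eq0 _ _ (\sum_i p i * g i ^+ 2)) => t.
have := h t; rewrite -subr_ge0; congr (0 <= _).
rewrite -sumrB mulr_sumr !mulr_suml -big_split; apply: eq_bigr => i _ /=.
ring.
Qed.

(* The smallest eigenvalue [sigma] of [L] absorbs the deviation of the empirical
   second moments, so these still dominate half of the form of [L]; the normal
   equation [ne] then bounds that form by [2 t \sum_i `|v i|]. *)
Lemma regression_error_le (R : realFieldType) d m (L : 'I_d -> 'I_d -> R)
    (X : 'I_m -> 'I_d -> R) (xi : 'I_m -> R) (v : 'I_d -> R) (t sigma : R)
    (N2 := \sum_k \sum_i v k * v i * L k i) :
  (0 < m)%N -> 0 < sigma -> 0 <= t -> 2 * d%:R * t <= sigma ->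
  sigma * \sum_i v i ^+ 2 <= N2 ->
  \sum_j (xi j - \sum_i v i * X j i) * (\sum_i v i * X j i) = 0 ->
  (forall k i, `|\sum_j (X j k * X j i - L k i)| <= m%:R * t) ->
  (forall i, `|\sum_j xi j * X j i| <= m%:R * t) ->
  sigma * N2 <= 4 * d%:R * t ^+ 2.
Proof.
move=> m0 s0 t0 td covL ne devL devg.
set U := \sum_i `|v i|; set Z := \sum_i v i ^+ 2 in covL.
have U0 : 0 <= U by apply: sumr_ge0.
have Z0 : 0 <= Z by apply: sumr_ge0 => i _; exact: sqr_ge0.
have UZ : U ^+ 2 <= d%:R * Z by exact: sqr_sum_norm_le.
have mR : 0 < m%:R :> R by rewrite ltr0n.
pose E := \sum_j (\sum_i v i * X j i) ^+ 2.
have dev : m%:R * N2 - E <= m%:R * t * U ^+ 2.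
  have -> : m%:R * N2 - E
      = - \sum_k \sum_i v k * v i * \sum_j (X j k * X j i - L k i).
    have -> : E = \sum_k \sum_i v k * v i * \sum_j X j k * X j i.
      rewrite /E; under eq_bigr => j _ do rewrite expr2 big_distrlr /=.
      rewrite exchange_big /=; apply: eq_bigr => k _.
      rewrite exchange_big /=; apply: eq_bigr => i _.
      by rewrite mulr_sumr; apply: eq_bigr => j _; ring.
    rewrite /N2 mulr_sumr -sumrB -sumrN; apply: eq_bigr => k _.
    rewrite mulr_sumr -sumrB -sumrN; apply: eq_bigr => i _.
    by rewrite sumrB sumr_const card_ord -[_ *+ m]mulr_natl; ring.
  rewrite -sumrN expr2 big_distrlr mulr_sumr /=; apply: ler_sum => k _.
  rewrite -sumrN mulr_sumr; apply: ler_sum => i _.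
  apply: le_trans (ler_norm _) _; rewrite normrN !normrM mulrC.
  by apply: ler_wpM2r; rewrite ?mulr_ge0.
have Eg : E <= m%:R * t * U.
  have -> : E = \sum_i v i * \sum_j xi j * X j i.
    have -> : E = \sum_j xi j * \sum_i v i * X j i.
      move/eqP: ne; under eq_bigr => j _ do rewrite mulrBl -expr2.
      by rewrite sumrB subr_eq0 => /eqP.
    under eq_bigr => j _ do rewrite mulr_sumr.
    rewrite exchange_big /=; apply: eq_bigr => i _.
    by rewrite mulr_sumr; apply: eq_bigr => j _; ring.
  rewrite mulr_sumr; apply: ler_sum => i _.
  apply: le_trans (ler_norm _) _; rewrite normrM mulrC.
  by apply: ler_wpM2r.
(* Together with [covL] this makes the deviation term [t * U ^+ 2] at most [N2 / 2]. *)
have tU : t * U ^+ 2 <= sigma / 2 * Z.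
  apply: (@le_trans _ _ (t * (d%:R * Z))); first exact: ler_wpM2l.
  by rewrite mulrA; apply: ler_wpM2r => //; lra.
have N2U : N2 <= 2 * t * U.
  rewrite -(ler_pM2l mR).
  have : m%:R * (t * U ^+ 2) <= m%:R * (N2 / 2).
    by apply: ler_wpM2l; [exact: ltW|lra].
  lra.
have N20 : 0 <= N2 by apply: le_trans covL; rewrite mulr_ge0 // ltW.
have [->|N2n0] := eqVneq N2 0.
  by rewrite mulr0 mulr_ge0 ?sqr_ge0 // mulr_ge0.
have N2gt0 : 0 < N2 by rewrite lt_neqAle eq_sym N2n0.
(* Squaring [N2U] gives [sigma N2^2 <= 4 t^2 sigma U^2 <= 4 d t^2 (sigma Z) <= 4 d t^2 N2], and one
   factor [N2] cancels. *)
rewrite -(ler_pM2r N2gt0).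
have -> : sigma * N2 * N2 = sigma * N2 ^+ 2 by ring.
apply: (@le_trans _ _ (sigma * (2 * t * U) ^+ 2)).
  apply: ler_wpM2l; first exact: ltW.
  by apply: lerXn2r; rewrite ?nnegrE ?mulr_ge0.
have -> : sigma * (2 * t * U) ^+ 2 = 4 * t ^+ 2 * sigma * U ^+ 2 by ring.
apply: (@le_trans _ _ (4 * t ^+ 2 * sigma * (d%:R * Z))).
  apply: ler_wpM2l => //; apply: mulr_ge0; last exact: ltW.
  by rewrite mulr_ge0 ?sqr_ge0.
have -> : 4 * t ^+ 2 * sigma * (d%:R * Z)
    = 4 * d%:R * t ^+ 2 * (sigma * Z) by ring.
by apply: ler_wpM2l => //; rewrite mulr_ge0 ?sqr_ge0 // mulr_ge0.
Qed.

(** * Law of a rollout *)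

(** Induction peeling off the first transition: [cons] and [tl] identify the longer paths from [z]
    with all shorter paths, which are then grouped by their starting point. *)
Lemma chain_sum1 (R : realType) (T : finType) (K : T -> T -> R) s (z : T) :
  (forall y, \sum_y' K y y' = 1) ->
  \sum_(tau : {ffun 'I_s.+1 -> T} | tau ord0 == z)
     \prod_(k < s) K (tau (widen_ord (leqnSn s) k)) (tau (lift ord0 k)) = 1.
Proof.
move=> K1; elim: s z => [|s IH] z.
  rewrite (big_pred1 [ffun=> z]) ?big_ord0 // => tau /=.
  apply/eqP/eqP => [tz|->]; last by rewrite ffunE.
  by apply/ffunP => i; rewrite ffunE (ord1 i).
pose cons (tau : {ffun 'I_s.+1 -> T}) : {ffun 'I_s.+2 -> T} :=
  [ffun i => oapp tau z (unlift ord0 i)].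
pose tl (tau : {ffun 'I_s.+2 -> T}) : {ffun 'I_s.+1 -> T} :=
  [ffun k => tau (lift ord0 k)].
have cons0 tau : cons tau ord0 = z by rewrite ffunE unlift_none.
have consS tau k : cons tau (lift ord0 k) = tau k by rewrite ffunE liftK.
rewrite (reindex_onto cons tl) => [|tau /eqP tz]; last first.
  apply/ffunP => i; case: (unliftP ord0 i) => [k|] ->; last by rewrite cons0.
  by rewrite consS ffunE.
rewrite (eq_bigl predT) => [|tau]; last first.
  rewrite cons0 eqxx; apply/eqP/ffunP => k; by rewrite ffunE consS.
rewrite (partition_big (fun tau : {ffun 'I_s.+1 -> T} => tau ord0) predT) //=.
rewrite -[RHS](K1 z); apply: eq_bigr => z' _.
rewrite -[RHS]mulr1 -[X in _ = _ * X](IH z') mulr_sumr.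
apply: eq_bigr => tau /eqP tz'.
rewrite big_ord_recl consS tz'; congr (K _ _ * _).
  by rewrite -(cons0 tau); congr (cons tau _); apply/val_inj.
apply: eq_bigr => k _; rewrite consS; congr (K _ _).
by rewrite -(consS tau); congr (cons tau _); apply/val_inj.
Qed.

Section Sampling.
Variables (R : realType) (S A s : nat).
Variables (P : 'I_S -> 'I_A -> 'I_S -> R) (c pi nu : 'I_S -> 'I_A -> R).
Hypotheses (mdp : is_mdp P c) (policy : is_policy pi).
Hypothesis nu_ge0 : forall x a, 0 <= nu x a.

Let p : traj S A s -> R := traj_pmf P pi nu (s := s).

Lemma traj_pmf_ge0 tau : 0 <= p tau.
Proof.
rewrite /p /traj_pmf mulr_ge0 // prodr_ge0 // => k _.
by apply: mulr_ge0; [exact: (mdp.1 _ _).1|exact: (policy _).1].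
Qed.

(** State-action pairs form a Markov chain with stochastic kernel [K], so the rollout sums out. *)
Lemma traj_pmf_start z :
  \sum_(tau : traj S A s | tau ord0 == z) p tau = nu z.1 z.2.
Proof.
pose K (y y' : 'I_S * 'I_A) := P y.1 y.2 y'.1 * pi y'.1 y'.2.
have K1 y : \sum_y' K y y' = 1.
  rewrite -(pair_bigA _ (fun x a => P y.1 y.2 x * pi x a)) /=.
  under eq_bigr => x _ do rewrite -mulr_sumr (policy x).2 mulr1.
  exact: (mdp.1 _ _).2.
rewrite -[RHS]mulr1 -[X in _ = _ * X](chain_sum1 s z K1) mulr_sumr.
by apply: eq_bigr => tau /eqP tz; rewrite /p /traj_pmf tz.
Qed.

Lemma traj_exp_start (h : 'I_S * 'I_A -> R) :
  \sum_tau p tau * h (tau ord0) = \sum_z nu z.1 z.2 * h z.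
Proof.
rewrite (partition_big (fun tau : traj S A s => tau ord0) predT) //=.
apply: eq_bigr => z _; rewrite -traj_pmf_start mulr_suml.
by apply: eq_bigr => tau /eqP ->.
Qed.

Lemma traj_exp_target (Q : 'I_S -> 'I_A -> R) (f : traj S A s -> R)
    (h : 'I_S * 'I_A -> R) :
  (forall x a, cond_exp_start p f x a = Q x a) ->
  \sum_tau p tau * (f tau * h (tau ord0))
    = \sum_z nu z.1 z.2 * (Q z.1 z.2 * h z).
Proof.
move=> fQ; rewrite (partition_big (fun tau : traj S A s => tau ord0) predT) //=.
apply: eq_bigr => z _.
transitivity ((\sum_(tau : traj S A s | tau ord0 == z) p tau * f tau) * h z).
  by rewrite mulr_suml; apply: eq_bigr => tau /eqP ->; rewrite mulrA.
rewrite mulrA; congr (_ * _).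
rewrite -fQ /cond_exp_start -surjective_pairing traj_pmf_start.
(* At a start of weight zero the conditional expectation is a division by zero; there every path has
   probability zero, so both sides vanish. *)
have [nu0|nu0] := eqVneq (nu z.1 z.2) 0; last by rewrite mulrC divfK.
rewrite nu0 mul0r big1 // => tau tz.
suff -> : p tau = 0 by rewrite mul0r.
move: (traj_pmf_start z); rewrite nu0 => /eqP.
rewrite psumr_eq0 => [/allP/(_ tau)|*]; last exact: traj_pmf_ge0.
by rewrite mem_index_enum tz => /(_ isT)/eqP.
Qed.

Lemma traj_pmf_dist : \sum_x \sum_a nu x a = 1 -> is_dist p.
Proof.
move=> nu1; split; first exact: traj_pmf_ge0.
have := traj_exp_start (fun=> 1).
under eq_bigr do rewrite mulr1; move=> ->.
by under eq_bigr do rewrite mulr1; rewrite -(pair_bigA _ nu).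
Qed.

(** The target is a sum of [s.+1] differences of two costs. *)
Lemma target_norm_le (tau : traj S A s) : `|target c tau| <= 2 * s.+1%:R.
Proof.
have c2 x a y b : `|c x a - c y b| <= 2.
  by rewrite (le_trans (ler_normB _ _)) // -[2]/(1 + 1) lerD // mdp.2.
rewrite /target (le_trans (ler_normD _ _)) //.
rewrite -[s.+1%:R]natr1 mulrDr mulr1 addrC.
apply: lerD => //; apply: (le_trans (ler_norm_sum _ _ _)).
apply: (@le_trans _ _ (\sum_(k < s) 2)); first exact: ler_sum.
by rewrite sumr_const card_ord mulr_natr.
Qed.

End Sampling.

(** * Feature covariance and the two normal equations *)

Section LinearFeatures.
Variables (R : realType) (S A d : nat).
Variables (nu : 'I_S -> 'I_A -> R) (Psi : 'M[R]_(S * A, d)).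

Let phi (z : 'I_S * 'I_A) (i : 'I_d) : R := Psi (mxvec_index z.1 z.2) i.

Lemma l2norm_coord_le n (v : 'cV[R]_n) i : `|v i 0| <= l2norm v.
Proof.
rewrite -sqrtr_sqr; apply: ler_wsqrtr.
by rewrite (bigD1 i) //= lerDl; apply: sumr_ge0 => k _; exact: sqr_ge0.
Qed.

Lemma lin_funE w x a : lin_fun Psi w x a = \sum_i w i 0 * phi (x, a) i.
Proof. by rewrite /lin_fun mxE; apply: eq_bigr => i _; rewrite mulrC. Qed.

Lemma featureE x a i : feature Psi x a i 0 = phi (x, a) i.
Proof. by rewrite !mxE. Qed.

Lemma dot_featureE (w : 'cV[R]_d) x a :
  (w^T *m feature Psi x a) 0 0 = \sum_i w i 0 * phi (x, a) i.
Proof. by rewrite mxE; apply: eq_bigr => i _; rewrite !mxE. Qed.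

Lemma cov_matrixE k i :
  cov_matrix nu Psi k i = \sum_z nu z.1 z.2 * (phi z k * phi z i).
Proof.
rewrite mxE (reindex (fun z : 'I_S * 'I_A => mxvec_index z.1 z.2)) /=.
  apply: eq_bigr => z _; rewrite mul_mx_diag !mxE mxvecE mxE /phi; ring.
have [g gK Kg] := @curry_mxvec_bij S A.
exists g => [[x a]|j] h; first exact: (gK (x, a)).
by rewrite -[RHS]Kg //; case: (g j).
Qed.

Lemma cov_matrix_sym : (cov_matrix nu Psi)^T = cov_matrix nu Psi.
Proof.
apply/matrixP => i k; rewrite mxE !cov_matrixE; apply: eq_bigr => z _; ring.
Qed.

Lemma sqr_wnormE (f : 'I_S -> 'I_A -> R) : (forall x a, 0 <= nu x a) ->
  wnorm nu f ^+ 2 = \sum_z nu z.1 z.2 * f z.1 z.2 ^+ 2.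
Proof.
move=> nu0; rewrite -(pair_bigA _ (fun x a => nu x a * f x a ^+ 2)).
rewrite sqr_sqrtr //.
by apply: sumr_ge0 => x _; apply: sumr_ge0 => a _; rewrite mulr_ge0 ?sqr_ge0.
Qed.

Lemma sqr_wnorm_lin w : (forall x a, 0 <= nu x a) ->
  wnorm nu (lin_fun Psi w) ^+ 2
    = \sum_k \sum_i w k 0 * w i 0 * cov_matrix nu Psi k i.
Proof.
move=> nu0; rewrite sqr_wnormE //.
under eq_bigr => z _.
  rewrite lin_funE -surjective_pairing expr2 big_distrlr mulr_sumr /=.
  under eq_bigr do rewrite mulr_sumr.
  over.
rewrite exchange_big /=; apply: eq_bigr => k _.
rewrite exchange_big /=; apply: eq_bigr => i _.
rewrite cov_matrixE mulr_sumr; apply: eq_bigr => z _; ring.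
Qed.

Lemma sqr_wnorm_lin_ge (sigma : R) (w : 'cV[R]_d) : (forall x a, 0 <= nu x a) ->
  lambda_min_ge (cov_matrix nu Psi) sigma ->
  sigma * \sum_i w i 0 ^+ 2 <= wnorm nu (lin_fun Psi w) ^+ 2.
Proof.
move=> nu0 hmin; have := symmetric_form_ge w^T cov_matrix_sym hmin.
under eq_bigr do rewrite mxE.
move=> /le_trans; apply; rewrite sqr_wnorm_lin // trmxK mxE exchange_big /=.
apply: ler_sum => i _; rewrite mxE mulr_suml; apply: ler_sum => k _.
by rewrite mxE; lra.
Qed.

(** Projection principle: [w] is minimal along the line [w + t *: h]. *)
Lemma best_approx_orthogonal (Q : 'I_S -> 'I_A -> R) (w h : 'cV[R]_d) :
  (forall x a, 0 <= nu x a) -> best_approx nu Psi Q w ->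
  \sum_z nu z.1 z.2 * ((Q z.1 z.2 - \sum_i w i 0 * phi z i)
                        * \sum_i h i 0 * phi z i) = 0.
Proof.
move=> nu0 hw; apply: weighted_normal_equation => t.
have wnorm0 f : wnorm nu f \is Num.nneg by rewrite nnegrE sqrtr_ge0.
have := hw (w + t *: h); rewrite -(@ler_pXn2r _ 2) // !sqr_wnormE //.
congr (_ <= _); apply: eq_bigr => z _; rewrite !lin_funE -surjective_pairing //.
congr (_ * _ ^+ 2); rewrite mulr_sumr -addrA -opprD -big_split; congr (_ - _).
by apply: eq_bigr => i _ /=; rewrite !mxE; ring.
Qed.

Lemma sq_loss_orthogonal (c : 'I_S -> 'I_A -> R) s m (D : dataset S A s m)
    (w h : 'cV[R]_d) :
  is_argmin (sq_loss c Psi D) w ->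
  \sum_j (target c (D j) - \sum_i w i 0 * phi (D j ord0) i)
           * (\sum_i h i 0 * phi (D j ord0) i) = 0.
Proof.
move=> hw.
have lossE w' : sq_loss c Psi D w'
    = \sum_j 1 * (target c (D j) - \sum_i w' i 0 * phi (D j ord0) i) ^+ 2.
  apply: eq_bigr => j _.
  by rewrite dot_featureE -surjective_pairing mul1r.
under eq_bigr do rewrite -[_ * _]mul1r.
apply: weighted_normal_equation => t.
have := hw (w + t *: h); rewrite !lossE; congr (_ <= _); apply: eq_bigr => j _.
congr (_ * _ ^+ 2); rewrite mulr_sumr -[RHS]addrA -opprD -big_split.
  congr (_ - _).
by apply: eq_bigr => i _ /=; rewrite !mxE; ring.
Qed.

End LinearFeatures.

(* C depends neither on m, delta, sigma nor on the particular P, c, policies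
   and features. Every delta in (0,1) is covered (dbar is arbitrary); the cap
   dbar only keeps log(1/delta) away from its zero at delta = 1. *)
Theorem lemma4p2 (R : realType) (S A d s : nat) (kappa Wmax B dbar : R)
    (hs : (0 < s)%N) (hkappa : 0 < kappa) (hdbar : 0 < dbar < 1) :
  exists C : R, 0 < C /\
  forall delta sigma : R, 0 < delta -> delta <= dbar -> 0 < sigma ->
  exists m0 : nat,
  forall (P : 'I_S -> 'I_A -> 'I_S -> R) (c : 'I_S -> 'I_A -> R)
         (pi pie : 'I_S -> 'I_A -> R) (mue : 'rV[R]_S) (lam : R)
         (Q : 'I_S -> 'I_A -> R) (Psi : 'M[R]_(S * A, d)) (wt : 'cV[R]_d),
  let nu : 'I_S -> 'I_A -> R := prod_unif mue in
  is_mdp P c ->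
  recurrent_mdp P ->
  uniformly_mixing P kappa ->
  is_policy pi ->
  average_cost P c pi lam ->
  action_value P c pi lam Q ->
  is_policy pie ->
  stationary P pie mue ->
  (forall x a, l2norm (feature Psi x a) <= B) ->
  (* best linear approximations are bounded, uniformly over policies *)
  (forall (pi' : 'I_S -> 'I_A -> R) (lam' : R) (Q' : 'I_S -> 'I_A -> R)
          (w' : 'cV[R]_d),
     is_policy pi' -> average_cost P c pi' lam' ->
     action_value P c pi' lam' Q' -> best_approx nu Psi Q' w' ->
     l2norm w' <= Wmax) ->
  (* the targets are unbiased *)
  (forall x a,
     cond_exp_start (traj_pmf P pi nu (s := s)) (target c (s := s)) x a
       = Q x a) ->
  lambda_min_ge (cov_matrix nu Psi) sigma ->
  best_approx nu Psi Q wt ->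
  forall m : nat, (m0 <= m)%N ->
  forall what : dataset S A s m -> 'cV[R]_d,
  (forall D, is_argmin (sq_loss c Psi D) (what D)) ->
  1 - delta <=
    data_prob (traj_pmf P pi nu (s := s))
      (fun D => wnorm nu (lin_fun Psi (what D - wt))
                  <= C * (Num.sqrt sigma)^-1
                       * Num.sqrt (ln (delta^-1) / m%:R)).
Proof.
have [dbar0 dbar1] := andP hdbar.
(* A positive lower bound for [ln (1 / delta)] over all [delta <= dbar]. *)
pose L0 : R := - ln dbar.
have L0gt0 : 0 < L0 by rewrite oppr_gt0 ln_lt0 // hdbar.
(* Bounds the union-bound factor [2 * (d.+1 * d)]: two signs for each test function. *)
pose M : R := 2 * (d.+1 ^ 2)%:R.
have M1 : 1 <= M by rewrite /M -natrM ler1n.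
have lnM : 0 <= ln M by exact: ln_ge0.
(* Chosen so that [c1 * L >= ln M + L] whenever [L >= L0], which absorbs the factor [M]. *)
pose c1 : R := ln M / L0 + 1.
have c10 : 0 < c1 by rewrite ltr_wpDl // divr_ge0 // ltW.
(* [W] bounds the prediction of [wt], and [K] every test function [f o]; the final [+ 1] keeps [K]
   positive. *)
pose W : R := d%:R * (`|Wmax| * `|B|).
pose K : R := 2 * `|B| ^+ 2 + (2 * s.+1%:R + W) * `|B| + 1.
have W0 : 0 <= W by rewrite !mulr_ge0.
have K0 : 0 < K.
  by rewrite ltr_wpDl // addr_ge0 // mulr_ge0 ?sqr_ge0 // addr_ge0 // mulr_ge0.
(* With [t^2 = G L / m] the Chernoff exponent is exactly [- c1 * L]. *)
pose G : R := 8 * K ^+ 2 * c1.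
have G0 : 0 < G by rewrite !mulr_gt0 // exprn_gt0.
exists (Num.sqrt (4 * d.+1%:R * G)); split.
  by rewrite sqrtr_gt0 !mulr_gt0 // ltr0n.
move=> delta sigma delta0 delta_dbar sigma0.
pose L : R := ln delta^-1.
have LE : L = - ln delta by rewrite /L lnV // posrE.
have L0L : L0 <= L by rewrite LE lerN2 ler_ln ?posrE.
have Lgt0 : 0 < L by exact: lt_le_trans L0L.
(* The two caps on [t]: one for the Chernoff bound, one for the regression lemma. The sample
   threshold below ensures [G L / m <= e^2]. *)
pose e : R := Num.min (2 * K) (sigma / (2 * d.+1%:R)).
have e0 : 0 < e.
  by rewrite lt_min mulr_gt0 //= divr_gt0 // mulr_gt0 // ltr0n.
exists (Num.truncn (G * L / e ^+ 2)).+1.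
move=> P c pi pie mue lam Q Psi wt nu mdp _ _ hpi hlam hQ hpie [mue_dist _].
move=> hB hWmax hunb hcov hwt m m0m what hwhat.
have m0 : (0 < m)%N by apply: leq_trans m0m.
have mR : 0 < m%:R :> R by rewrite ltr0n.
pose t : R := Num.sqrt (G * (L / m%:R)).
have t2 : t ^+ 2 = G * (L / m%:R).
  by rewrite sqr_sqrtr // mulr_ge0 ?divr_ge0 // ltW.
have t0 : 0 <= t by exact: sqrtr_ge0.
have te : t <= e.
  rewrite -(@ler_pXn2r _ 2) ?nnegrE ?(ltW e0) // t2 mulrA ler_pdivrMr //.
  rewrite [leRHS]mulrC -ler_pdivrMr ?exprn_gt0 //.
  by apply: le_trans (ltW (truncnS_gt _)) _; rewrite ler_nat.
have tK : t <= 2 * K by apply: le_trans te _; rewrite ge_min lexx.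
have tsigma : 2 * d%:R * t <= sigma.
  have : t <= sigma / (2 * d.+1%:R).
    by apply: le_trans te _; rewrite ge_min lexx orbT.
  rewrite ler_pdivlMr ?mulr_gt0 ?ltr0n // => /(le_trans _); apply.
  rewrite mulrC; apply: ler_wpM2l => //; apply: ler_wpM2l => //.
  by rewrite ler_nat.
have [mue0 mue1] := mue_dist.
have nu0 x a : 0 <= nu x a by rewrite mulr_ge0 ?invr_ge0.
have nu1 : \sum_x \sum_a nu x a = 1.
  (* [mue] has mass 1, so a state exists; a policy has mass 1 there, so [A] is nonzero and the
     uniform weights sum to 1. *)
  have [x _] : exists x : 'I_S, true.
    case: (pickP (fun _ : 'I_S => true)) => [x _|h]; first by exists x.
    by move: mue1; rewrite big_pred0 // => /eqP; rewrite eq_sym oner_eq0.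
  have A0 : A%:R != 0 :> R.
    rewrite pnatr_eq0; apply/eqP => A0; have := (hpi x).2.
    rewrite big1 => [/eqP|a]; first by rewrite eq_sym oner_eq0.
    by have := leq_ltn_trans (leq0n a) (ltn_ord a); rewrite A0.
  rewrite -mue1; apply: eq_bigr => y _.
  by rewrite /nu /prod_unif sumr_const card_ord -[LHS]mulr_natr mulfVK.
pose p := traj_pmf P pi nu (s := s).
have p_dist : is_dist p by exact: traj_pmf_dist mdp hpi nu0 nu1.
pose phi (z : 'I_S * 'I_A) (i : 'I_d) : R := Psi (mxvec_index z.1 z.2) i.
have phiB z i : `|phi z i| <= `|B|.
  have -> : phi z i = feature Psi z.1 z.2 i 0 by rewrite featureE.
  rewrite (le_trans (l2norm_coord_le _ _)) //.
  exact: le_trans (hB _ _) (ler_norm _).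
have wtW i : `|wt i 0| <= `|Wmax|.
  rewrite (le_trans (l2norm_coord_le _ _)) //.
  exact: le_trans (hWmax pi lam Q wt hpi hlam hQ hwt) (ler_norm _).
pose Sg := cov_matrix nu Psi.
pose xi (tau : traj S A s) : R :=
  target c tau - \sum_i wt i 0 * phi (tau ord0) i.
have xiB tau : `|xi tau| <= 2 * s.+1%:R + W.
  rewrite (le_trans (ler_normB _ _)) // lerD //.
    exact: target_norm_le mdp _.
  rewrite (le_trans (ler_norm_sum _ _ _)) // /W mulr_natl.
  rewrite -[X in _ *+ X]card_ord -sumr_const; apply: ler_sum => i _.
  by rewrite normrM ler_pM.
(* One family for a single union bound: [Some k] gives the centered second moments, [None] the
   residual of [wt] times a feature. *)
pose f (o : option 'I_d * 'I_d) (tau : traj S A s) : R :=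
  if o.1 is Some k then phi (tau ord0) k * phi (tau ord0) o.2 - Sg k o.2
  else xi tau * phi (tau ord0) o.2.
have phi2B z k i : `|phi z k * phi z i| <= `|B| ^+ 2.
  by rewrite normrM expr2 ler_pM.
have SgB k i : `|Sg k i| <= `|B| ^+ 2.
  rewrite /Sg cov_matrixE (le_trans (ler_norm_sum _ _ _)) //.
  apply: (@le_trans _ _ (\sum_z nu z.1 z.2 * `|B| ^+ 2)).
    apply: ler_sum => z _; rewrite normrM ger0_norm //.
    by apply: ler_wpM2l => //; exact: phi2B.
  by rewrite -mulr_suml -(pair_bigA _ nu) nu1 mul1r.
have fK o tau : `|f o tau| <= K.
  have B2 : 0 <= `|B| ^+ 2 by exact: sqr_ge0.
  have sW : 0 <= 2 * s.+1%:R + W by rewrite addr_ge0 // mulr_ge0.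
  have sWB : 0 <= (2 * s.+1%:R + W) * `|B| by rewrite mulr_ge0.
  rewrite /f /K; case: o => [[k|] i] /=.
    have := ler_normB (phi (tau ord0) k * phi (tau ord0) i) (Sg k i).
    have := phi2B (tau ord0) k i; have := SgB k i; lra.
  have : `|xi tau * phi (tau ord0) i| <= (2 * s.+1%:R + W) * `|B|.
    by rewrite normrM ler_pM.
  lra.
have f0 o : \sum_tau p tau * f o tau = 0.
  rewrite /f; case: o => [[k|] i] /=.
    under eq_bigr do rewrite mulrBr.
    rewrite sumrB -mulr_suml p_dist.2 mul1r.
    rewrite (@traj_exp_start _ _ _ s _ _ _ nu mdp hpi
      (fun z => phi z k * phi z i)).
    by rewrite /Sg cov_matrixE subrr.
  (* Unbiasedness replaces the target by [Q], and optimality of [wt] in the direction of the [i]-th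
     basis vector gives mean zero. *)
  have deltaE z : \sum_i0 (delta_mx i 0 : 'cV[R]_d) i0 0 * phi z i0 = phi z i.
    rewrite (bigD1 i) //= mxE !eqxx mul1r big1 ?addr0 // => j ji.
    by rewrite mxE (negbTE ji) mul0r.
  have orth : \sum_z nu z.1 z.2 * (Q z.1 z.2 * phi z i)
      - \sum_z nu z.1 z.2 * ((\sum_j wt j 0 * phi z j) * phi z i) = 0.
    rewrite -sumrB -[RHS](best_approx_orthogonal (delta_mx i 0) nu0 hwt).
    by apply: eq_bigr => z _; rewrite deltaE mulrBl mulrBr.
  under eq_bigr => tau _ do rewrite /xi mulrBl mulrBr.
  rewrite sumrB (traj_exp_target mdp hpi nu0 (phi^~ i) hunb).
  by rewrite (@traj_exp_start _ _ _ s _ _ _ nu mdp hpi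
    (fun z => (\sum_j wt j 0 * phi z j) * phi z i)).
have := uniform_deviation p_dist m K0 t0 tK fK f0.
move=> hdev; apply: (@le_trans _ _ (1 - delta)) => //.
apply: le_trans (le_trans hdev _).
  rewrite lerD2l lerN2.
  have -> : - (m%:R * t ^+ 2 / (8 * K ^+ 2)) = - (c1 * L).
    by rewrite t2 /G; field; rewrite !gt_eqF.
  have hexp : expR (- (c1 * L)) <= expR (- (ln M + L)).
    rewrite ler_expR lerN2 /c1 mulrDl mul1r lerD2r mulrAC -mulrA ler_peMr //.
    by rewrite ler_pdivlMr // mul1r.
  have hM : expR (- (ln M + L)) = delta / M.
    rewrite LE opprD opprK expRD expRN lnK ?posrE ?(lt_le_trans ltr01) //.
    by rewrite lnK ?posrE // mulrC.
  rewrite hM in hexp.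
  apply: (@le_trans _ _ (M * (delta / M))).
    rewrite mulrA; apply: ler_pM;
      [exact: mulr_ge0|exact: expR_ge0| |exact: hexp].
    rewrite card_prod card_option !card_ord /M mulrC; apply: ler_wpM2l => //.
    by rewrite ler_nat expnS expn1 leq_mul2l ltnW.
  by rewrite mulrCA divff ?mulr1 // gt_eqF // (lt_le_trans ltr01).
apply: (iid_prob_mono p_dist) => D /forallP devD.
pose v := what D - wt.
have main : sigma * wnorm nu (lin_fun Psi v) ^+ 2 <= 4 * d%:R * t ^+ 2.
  rewrite sqr_wnorm_lin //.
  apply: (@regression_error_le _ _ m Sg (fun j => phi (D j ord0))
            (fun j => xi (D j)) (fun i => v i 0)) => //.
  - by rewrite -sqr_wnorm_lin //; exact: sqr_wnorm_lin_ge.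
  (* Since [what D = wt + v], the residual of [what D] is [xi] minus the prediction of [v]. *)
  - rewrite -[RHS](sq_loss_orthogonal v (hwhat D)); apply: eq_bigr => j _.
    congr (_ * _); rewrite /xi -[LHS]addrA -opprD -big_split; congr (_ - _).
    by apply: eq_bigr => i _ /=; rewrite /v !mxE /phi; ring.
  - by move=> k i; exact: (devD (Some k, i)).
  - by move=> i; exact: (devD (None, i)).
rewrite -(@ler_pXn2r _ 2) ?nnegrE ?sqrtr_ge0 ?mulr_ge0 ?invr_ge0 ?sqrtr_ge0 //.
have C2 : Num.sqrt (4 * d.+1%:R * G) ^+ 2 = 4 * d.+1%:R * G.
  by rewrite sqr_sqrtr // mulr_ge0 ?mulr_ge0 // ltW.
have Lm2 : Num.sqrt (ln delta^-1 / m%:R) ^+ 2 = L / m%:R.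
  by rewrite sqr_sqrtr // divr_ge0 // ltW.
rewrite !exprMn exprVn C2 Lm2 (sqr_sqrtr (ltW sigma0)).
rewrite mulrAC ler_pdivlMr // mulrC (le_trans main) // t2.
rewrite mulrA; apply: ler_wpM2r; first by rewrite divr_ge0 // ltW.
apply: ler_wpM2r; first exact: ltW.
by apply: ler_wpM2l => //; rewrite ler_nat.
Qed.
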